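(* Let $p$ be a prime, $n=rk$, $k>1$, $f:\mathbb{F}_{p^n}\to\mathbb{F}_{p^k}$, $h:\mathbb{F}_{p^k}\to\mathbb{F}_{p^k}$, and let $\gamma\in\mathbb{F}_{p^n}^*$ be a $0$-linear translator of $f$. Define $F(x)=x+\gamma h(f(x))$ on $\mathbb{F}_{p^n}$. Then $F_p(x)=x$ for all $x$, so that $$F^{-1}(x)=F_{p-1}(x)=x+(p-1)\gamma h(f(x)).$$ In particular, $F$ is an involution when $p=2$.
   Context: $\gamma$ is a $b$-linear translator of $f$ (with $b\in\mathbb{F}_{p^k}$) if $f(x+u\gamma)-f(x)=ub$ for all $x\in\mathbb{F}_{p^n}$ and all $u\in\mathbb{F}_{p^k}$; a $0$-linear translator is the case $b=0$. $F_t$ denotes the $t$-fold composition $F\circ\cdots\circ F$ ($t$ times), and $F^{-1}$ the compositional inverse. *)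

(* Defs.v *)
From HB Require Import structures.
From mathcomp Require Import all_boot all_order all_algebra all_field.

Set Implicit Arguments.
Unset Strict Implicit.
Unset Printing Implicit Defensive.

Import GRing.Theory.
Local Open Scope ring_scope.

(* The inclusion of F_{p^k} into F_{p^n} is rendered by a ring morphism        *)
(* iota : K -> L between finite fields (automatically injective); the product  *)
(* of u in F_{p^k} by gamma in F_{p^n} is iota u * gamma.                      *)

Definition linear_translator (K L : finFieldType) (iota : {rmorphism K -> L})
    (f : L -> K) (b : K) (gamma : L) : Prop :=
  forall (x : L) (u : K), f (x + iota u * gamma) - f x = u * b.

Definition translator_map (K L : finFieldType) (iota : {rmorphism K -> L})
    (f : L -> K) (h : K -> K) (gamma : L) : L -> L :=
  fun x => x + gamma * iota (h (f x)).

(* Main.v *)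
(* A 0-linear translator leaves f constant along gamma * F_{p^k}, so f is
   invariant under F: each iteration of F adds the same vector
   gamma * h(f(x)), and adding it p times gives 0 in characteristic p. *)

Require Import Defs.
From HB Require Import structures.
From mathcomp Require Import all_boot all_order all_algebra all_field.

Set Implicit Arguments.
Unset Strict Implicit.
Unset Printing Implicit Defensive.

Import GRing.Theory.
Local Open Scope ring_scope.

(** The translator identity is taken at [u = h (f x)], exactly the multiple of [gamma] that the map
    adds to [x]. *)
Lemma translator_map_invariant (K L : finFieldType) (iota : {rmorphism K -> L})
    (f : L -> K) (h : K -> K) (gamma : L) (x : L) :
  linear_translator iota f 0 gamma -> f (translator_map iota f h gamma x) = f x.
Proof.
move=> /(_ x (h (f x))) /eqP.
by rewrite mulr0 subr_eq0 /translator_map mulrC => /eqP.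
Qed.

Lemma iter_translator_map (K L : finFieldType) (iota : {rmorphism K -> L})
    (f : L -> K) (h : K -> K) (gamma : L) (t : nat) (x : L) :
  linear_translator iota f 0 gamma ->
  iter t (translator_map iota f h gamma) x = x + t%:R * gamma * iota (h (f x)).
Proof.
move=> tr_gamma; set F := translator_map iota f h gamma.
have fF s : f (iter s F x) = f x.
  by elim: s => //= s IHs; rewrite translator_map_invariant.
elim: t => [|t IHt] /=; first by rewrite !mul0r addr0.
(* Only the outermost [F] is unfolded; [fF] turns its increment into the one at [x], which joins the
   [t] copies already added. *)
by rewrite {1}/F /translator_map fF IHt -addrA -!mulrA !mulr_natl -mulrSr.
Qed.

Theorem proposition4 (p n r k : nat) (p_prime : prime p)
    (n_eq : n = (r * k)%N) (k_gt1 : (1 < k)%N)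
    (K L : finFieldType) (cardK : #|K| = (p ^ k)%N) (cardL : #|L| = (p ^ n)%N)
    (iota : {rmorphism K -> L})
    (f : L -> K) (h : K -> K) (gamma : L) (gamma_neq0 : gamma != 0)
    (gamma_translator : linear_translator iota f 0 gamma) :
  let F := translator_map iota f h gamma in
  [/\ forall x : L, iter p F x = x,
      exists injF : injective F, forall x : L,
        invF injF x = iter (p - 1) F x /\
        iter (p - 1) F x = x + (p - 1)%:R * gamma * iota (h (f x))
    & p = 2%N -> involutive F].
Proof.
move=> F.
have iterF t x : iter t F x = x + t%:R * gamma * iota (h (f x)).
  exact: iter_translator_map.
have iterpF x : iter p F x = x.
  (* The cardinality [p ^ n] forces [L] to have characteristic [p], so [p%:R = 0]. *)
  by rewrite iterF (pcharf0 (card_finPcharP cardL p_prime)) !mul0r addr0.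
have p_gt0 := prime_gt0 p_prime.
(* Composing [F] with its iterate of order [p - 1], on either side, gives the identity [iter p F];
   [p_gt0] keeps the truncated subtraction exact. *)
have iterF_K : cancel F (iter (p - 1) F).
  by move=> x; rewrite -iterSr subn1 prednK.
have F_iterK : cancel (iter (p - 1) F) F.
  by move=> x; rewrite -iterS subn1 prednK.
split=> // [|p2 x]; last by rewrite -[RHS]iterpF p2.
exists (can_inj iterF_K) => x; split; last exact: iterF.
(* Both candidates for the inverse are sent to [x] by the injective [F]. *)
by apply: (can_inj iterF_K); rewrite f_invF F_iterK.
Qed.
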